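(* With $s=\sqrt{(u_3+u_4)^2-4u_1u_2}$, $$\sum_{n\geq0}P_n(u_1,u_2,u_3,u_4\mid\alpha,\beta)\frac{t^n}{n!}=e^{\frac12(\beta-\alpha)(u_3-u_4)t}\left(\cosh\Bigl(\frac{st}{2}\Bigr)-\frac{u_3+u_4}{s}\sinh\Bigl(\frac{st}{2}\Bigr)\right)^{-(\alpha+\beta)}.$$
   Context: For $\sigma=\sigma_1\cdots\sigma_m\in\mathfrak S_m$: ${\rm LRmax}(\sigma)$ is the number of $i$ with $\sigma_j<\sigma_i$ for all $j<i$; ${\rm RLmax}(\sigma)$ is the number of $i$ with $\sigma_j<\sigma_i$ for all $j>i$. With the convention $\sigma_0=\sigma_{m+1}=0$: ${\rm W}(\sigma)$ is the number of $i\in[m]$ with $\sigma_{i-1}<\sigma_i>\sigma_{i+1}$; ${\rm V}(\sigma)$ is the number of $i$ with $1<i<m$ and $\sigma_{i-1}>\sigma_i<\sigma_{i+1}$; ${\rm rdd}(\sigma)$ is the number of $i$ with $1<i\le m$ and $\sigma_{i-1}>\sigma_i>\sigma_{i+1}$; ${\rm lda}(\sigma)$ is the number of $i$ with $1\le i<m$ and $\sigma_{i-1}<\sigma_i<\sigma_{i+1}$. Define $$P_n(u_1,u_2,u_3,u_4\mid\alpha,\beta)=\sum_{\sigma\in\mathfrak S_{n+1}}u_1^{{\rm V}(\sigma)}u_2^{{\rm W}(\sigma)-1}u_3^{{\rm rdd}(\sigma)}u_4^{{\rm lda}(\sigma)}\alpha^{{\rm LRmax}(\sigma)-1}\beta^{{\rm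 RLmax}(\sigma)-1}.$$ All series are formal power series in $t$; the bracketed series only involves even powers of $s$ (so no square root actually appears) and has constant term $1$, and $G^{c}:=\exp(c\log G)$ for such $G$. *)

(* Defs.v *)
From mathcomp Require Import all_boot all_order all_algebra all_fingroup.
Set Implicit Arguments. Unset Strict Implicit. Unset Printing Implicit Defensive.
Import Order.TTheory GRing.Theory Num.Theory.
Local Open Scope ring_scope.

(* For s : 'S_m, the word s_1 ... s_m uses values 1..m (val (s (i-1)) + 1),
   with the convention s_0 = s_{m+1} = 0. *)
Definition pw (m : nat) (s : 'S_m) (i : nat) : nat :=
  if (1 <= i <= m)%N then
    (if insub (i.-1) is Some j then (val (s j)).+1 else 0%N)
  else 0%N.

Definition LRmax m (s : 'S_m) : nat :=
  count (fun i => all (fun j => pw s j < pw s i)%N (iota 1 i.-1)) (iota 1 m).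
Definition RLmax m (s : 'S_m) : nat :=
  count (fun i => all (fun j => pw s j < pw s i)%N (iota i.+1 (m - i))) (iota 1 m).
Definition Wst m (s : 'S_m) : nat :=
  count (fun i => (pw s i.-1 < pw s i)%N && (pw s i.+1 < pw s i)%N) (iota 1 m).
Definition Vst m (s : 'S_m) : nat :=
  count (fun i => [&& (1 < i)%N, (i < m)%N, (pw s i < pw s i.-1)%N
                     & (pw s i < pw s i.+1)%N]) (iota 1 m).
Definition rdd m (s : 'S_m) : nat :=
  count (fun i => [&& (1 < i)%N, (pw s i < pw s i.-1)%N
                     & (pw s i.+1 < pw s i)%N]) (iota 1 m).
Definition lda m (s : 'S_m) : nat :=
  count (fun i => [&& (i < m)%N, (pw s i.-1 < pw s i)%N
                     & (pw s i < pw s i.+1)%N]) (iota 1 m).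

Definition Pn (K : comRingType) (n : nat) (u1 u2 u3 u4 a b : K) : K :=
  \sum_(s : 'S_n.+1)
     u1 ^+ Vst s * u2 ^+ (Wst s).-1 * u3 ^+ rdd s * u4 ^+ lda s
       * a ^+ (LRmax s).-1 * b ^+ (RLmax s).-1.

Definition fps (K : Type) := nat -> K.

Definition fps_one (K : fieldType) : fps K := fun n => (n == 0%N)%:R.
Definition fps_mul (K : fieldType) (f g : fps K) : fps K :=
  fun n => \sum_(i < n.+1) f i * g (n - i)%N.
Fixpoint fps_pown (K : fieldType) (f : fps K) (k : nat) : fps K :=
  match k with
  | 0 => fps_one K
  | k.+1 => fps_mul f (fps_pown f k)
  end.
(* exp f = sum_k f^k / k!, for f with zero constant term *)
Definition fps_exp (K : fieldType) (f : fps K) : fps K :=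
  fun n => \sum_(k < n.+1) fps_pown f k n / (k`!)%:R.
(* log G = sum_{k>=1} (-1)^(k+1) (G-1)^k / k, for G with constant term 1 *)
Definition fps_log (K : fieldType) (G : fps K) : fps K :=
  let H := fun n => if n == 0%N then G 0%N - 1 else G n in
  fun n => \sum_(1 <= k < n.+1) ((-1) ^+ k.+1 / k%:R) * fps_pown H k n.
Definition fps_cpow (K : fieldType) (G : fps K) (c : K) : fps K :=
  fps_exp (fun n => c * fps_log G n).
Definition fps_lin (K : fieldType) (c : K) : fps K :=
  fun n => if n == 1%N then c else 0.

(* cosh(s t/2) - (u3+u4)/s sinh(s t/2), expanded in powers of s^2 = D,
   D = (u3+u4)^2 - 4 u1 u2:
   coefficient of t^(2m)   is  D^m / (2^(2m) (2m)!),
   coefficient of t^(2m+1) is -(u3+u4) D^m / (2^(2m+1) (2m+1)!). *)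
Definition bracket (K : fieldType) (u1 u2 u3 u4 : K) : fps K :=
  let D := (u3 + u4) ^+ 2 - 4%:R * u1 * u2 in
  fun n => if ~~ odd n then D ^+ n./2 / (2 ^ n * n`!)%:R
           else - (u3 + u4) * D ^+ n./2 / (2 ^ n * n`!)%:R.

Definition rhs (K : fieldType) (u1 u2 u3 u4 a b : K) : fps K :=
  fps_mul (fps_exp (fps_lin ((b - a) * (u3 - u4) / 2%:R)))
          (fps_cpow (bracket u1 u2 u3 u4) (- (a + b))).

(* Main.v *)
(* Let x = u1 u2, y = u3, z = u4; since W = V + 1, the weight of a permutation
   is x^V y^rdd z^lda a^(LRmax-1) b^(RLmax-1).  Inserting a new smallest letter
   in front contributes a z, inserting it at the end contributes b y, and the
   interior insertions act as the derivation with x' = x (y + z), y' = z' = x.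
   So whenever x, y, z live in a differential ring, satisfy these equations and
   E' = (a z + b y) E, the n-th derivative of E is P_n E.  In the ring of formal
   power series in t, with G the bracketed series, a solution with the prescribed
   constant terms is x = u1 u2 / G^2, y = - G'/G + (u3 - u4)/2,
   z = - G'/G - (u3 - u4)/2, and E is the right-hand side; taking the constant
   term of the n-th derivative of E gives the n-th coefficient. *)
From HB Require Import structures.
Require Import Defs.
From mathcomp Require Import all_boot all_order all_algebra all_fingroup.
From mathcomp Require Import boolp ring zify.
Import GRing.Theory.
Local Open Scope ring_scope.

(** * Permutations as words, with statistics by recursion along the word *)

Section Words.
Set Implicit Arguments. Unset Strict Implicit.

(** The argument [a] is the letter before the word, and [head 0] supplies the value 0 after the last
    letter. *)
Fixpoint count3 (Q : nat -> nat -> nat -> bool) (a : nat) (w : seq nat) : nat :=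
  if w is b :: w' then (Q a b (head 0 w') + count3 Q b w')%N else 0%N.

(** Here [m] is the maximum of the letters already read. *)
Fixpoint lr_max (m : nat) (w : seq nat) : nat :=
  if w is b :: w' then ((m < b) + lr_max (maxn m b) w')%N else 0%N.

Fixpoint rl_max (w : seq nat) : nat :=
  if w is b :: w' then (all (gtn b) w' + rl_max w')%N else 0%N.

Lemma count3E Q a w : count3 Q a w =
  count (fun i => Q (nth 0 (a :: w) i.-1) (nth 0 (a :: w) i)
                    (nth 0 (a :: w) i.+1))%N (iota 1 (size w)).
Proof.
elim: w a => [//|b w IH] a /=; congr (_ + _)%N.
rewrite IH (iotaDl 1 1) count_map; apply: eq_in_count => i.
by rewrite mem_iota => /andP[i1 _] /=; case: i i1.
Qed.

Lemma lr_maxE m w : lr_max m w =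
  count (fun i => (m < nth 0 w i) && all (gtn (nth 0 w i)) (take i w))%N
    (iota 0 (size w)).
Proof.
elim: w m => [//|b w IH] m /=; rewrite andbT; congr (_ + _)%N.
rewrite IH (iotaDl 1 0) count_map; apply: eq_count => i /=.
by rewrite gtn_max andbA.
Qed.

Lemma rl_maxE w : rl_max w =
  count (fun i => all (gtn (nth 0 w i)) (drop i.+1 w))%N (iota 0 (size w)).
Proof.
elim: w => [//|b w IH] /=; rewrite drop0; congr (_ + _)%N.
by rewrite IH (iotaDl 1 0) count_map.
Qed.

Definition word m (s : 'S_m) : seq nat := [seq (val (s j)).+1 | j <- enum 'I_m].

Lemma size_word m (s : 'S_m) : size (word s) = m.
Proof. by rewrite size_map size_enum_ord. Qed.

Lemma nth_word m (s : 'S_m) (j : 'I_m) : nth 0%N (word s) j = (val (s j)).+1.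
Proof. by rewrite (nth_map j) ?nth_ord_enum // size_enum_ord. Qed.

Lemma word_gt0 m (s : 'S_m) : all (ltn 0) (word s).
Proof. by apply/allP => _ /mapP[j _ ->]. Qed.

Lemma word_uniq m (s : 'S_m) : uniq (0%N :: word s).
Proof.
rewrite cons_uniq; apply/andP; split; first by apply/negP => /mapP[].
rewrite map_inj_uniq ?enum_uniq // => i j [] /val_inj; exact: perm_inj.
Qed.

(** Past the end, the default value of [nth] serves as the boundary letter 0. *)
Lemma pwE m (s : 'S_m) i : pw s i = nth 0%N (0%N :: word s) i.
Proof.
rewrite /pw; case: i => [//|i] /=; case: ltnP => [lim|lmi].
  by rewrite insubT (nth_word s (Ordinal lim)).
by rewrite nth_default // size_word.
Qed.

Lemma LRmaxE m (s : 'S_m) : LRmax s = lr_max 0 (word s).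
Proof.
rewrite /LRmax lr_maxE size_word (iotaDl 1 0) count_map.
apply: eq_in_count => i; rewrite mem_iota add0n /= => lim.
rewrite pwE /= (iotaDl 1 0) all_map.
have -> : (0 < nth 0 (word s) i)%N.
  by apply: (allP (word_gt0 s)); rewrite mem_nth ?size_word.
rewrite /= -(map_nth_iota0 0%N) ?size_word 1?ltnW // all_map.
by apply: eq_all => j /=; rewrite pwE.
Qed.

Lemma RLmaxE m (s : 'S_m) : RLmax s = rl_max (word s).
Proof.
rewrite /RLmax rl_maxE size_word (iotaDl 1 0) count_map.
apply: eq_in_count => i; rewrite mem_iota add0n /= => lim.
have := @map_nth_iota _ 0%N (word s) i.+1 (m - i.+1)%N.
rewrite size_word leqnn take_oversize ?size_drop ?size_word // => <- //.
rewrite add1n (iotaDl 1 i.+1) !all_map; apply: eq_all => j /=.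
by rewrite !pwE.
Qed.

Definition isW (a b c : nat) := (a < b)%N && (c < b)%N.
Definition isV (a b c : nat) := (b < a)%N && (b < c)%N.
Definition isrdd (a b c : nat) := (b < a)%N && (c < b)%N.
Definition islda (a b c : nat) := (a < b)%N && (b < c)%N.

Lemma WstE m (s : 'S_m) : Wst s = count3 isW 0 (word s).
Proof. by rewrite count3E size_word; apply: eq_count => i; rewrite !pwE. Qed.

Lemma pw_bnd m (s : 'S_m) : (pw s 0 = 0%N) * (pw s m.+1 = 0%N).
Proof. by rewrite !pwE /= nth_default // size_word. Qed.

(** The bounds on [i] are automatic for a valley, since no letter lies below the boundary value 0;
    likewise for [rdd] and [lda]. *)
Lemma VstE m (s : 'S_m) : Vst s = count3 isV 0 (word s).
Proof.
rewrite count3E size_word; apply: eq_in_count => i; rewrite mem_iota -!pwE /isV.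
case: i => [//|[//|i]] /=.
by case: (ltngtP i.+2 m) => // [|->]; [lia | rewrite pw_bnd ltn0 andbF].
Qed.

Lemma rddE m (s : 'S_m) : rdd s = count3 isrdd 0 (word s).
Proof.
rewrite count3E size_word; apply: eq_in_count => i; rewrite mem_iota -!pwE /isrdd.
by case: i => [|[]].
Qed.

Lemma ldaE m (s : 'S_m) : lda s = count3 islda 0 (word s).
Proof.
rewrite count3E size_word; apply: eq_in_count => i; rewrite mem_iota -!pwE /islda.
by case: (ltngtP i m) => // [|->]; [lia | rewrite pw_bnd ltn0 andbF].
Qed.

(** Peaks and valleys alternate, and the path ends with a descent to 0. Starting with an ascent
    gives one peak more than valleys, starting with a descent equally many. *)
Lemma count3_WV a b w : uniq (a :: b :: w) -> all (ltn 0) (b :: w) ->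
  (count3 isW a (b :: w) + (b < a) = (count3 isV a (b :: w)).+1)%N.
Proof.
elim: w a b => [|c w IH] a b.
  by rewrite /= /isW /isV inE => /andP[ab _] /andP[-> _]; lia.
move=> /[dup] /andP[ab _] /andP[_ U] /= /andP[b0 p].
have := IH b c U p; rewrite /= /isW /isV.
have bc : b != c by move: U => /=; rewrite inE negb_or => /andP[/andP[]].
have {}ab : a != b by move: ab; rewrite inE negb_or => /andP[].
lia.
Qed.

(* The inserted letter 1 is meant to be smaller than all letters of w. *)
Definition ins (k : nat) (w : seq nat) : seq nat := take k w ++ 1%N :: drop k w.

(* Shifts all letters up by one but keeps the boundary value 0. *)
Definition shift (b : nat) : nat := (b + (0 < b))%N.

Lemma ltn_shift a b : (shift a < shift b)%N = (a < b)%N.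
Proof. rewrite /shift; lia. Qed.

(** [lift_perm i ord0 s] takes the smallest value at position [i] and runs through [s], raised by
    one, elsewhere. *)
Lemma word_lift_perm m (i : 'I_m.+1) (s : 'S_m) :
  word (lift_perm i ord0 s) = ins i (map shift (word s)).
Proof.
have sz : size (map shift (word s)) = m by rewrite size_map size_word.
have im : (i <= m)%N by rewrite -ltnS.
apply: (@eq_from_nth _ 0%N) => [|j].
  by rewrite size_cat /= size_takel ?size_drop ?sz // size_word; lia.
rewrite size_word => jm; rewrite -[j]/(val (Ordinal jm)).
rewrite nth_cat size_takel ?sz //.
case: (unliftP i (Ordinal jm)) => [k|] ->; last first.
  by rewrite nth_word lift_perm_id ltnn subnn.
rewrite nth_word lift_perm_lift /= /bump add1n.
have E : nth 0%N (map shift (word s)) k = (val (s k)).+2.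
  by rewrite (nth_map 0%N) ?size_word // nth_word /shift addn1.
case: (leqP i k) => ik; last by rewrite add0n ik nth_take.
rewrite add1n ltnNge (leqW ik) /= subSn // /= nth_drop subnKC //.
Qed.

(** * Weights of words and insertion of a smallest letter *)

Section Weights.
Variable R : comNzRingType.
Implicit Types (x y z a b : R) (w : seq nat).

(** The factor of the letter [j] between [i] and [k]. A peak gets 1, since the factor [x = u1 u2] of
    a valley pays for a peak too. *)
Definition tau x y z (i j k : nat) : R :=
  if (i < j)%N then if (j < k)%N then z else 1
  else if (j < k)%N then x else y.

Fixpoint wt x y z (i : nat) w : R :=
  if w is j :: w' then tau x y z i j (head 0%N w') * wt x y z j w' else 1.

Lemma wtE x y z i w : uniq (i :: w) -> all (ltn 0) w ->
  wt x y z i w = x ^+ count3 isV i w * y ^+ count3 isrdd i w *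
                 z ^+ count3 islda i w.
Proof.
elim: w i => [|j w IH] i; first by rewrite !expr0 !mulr1.
rewrite cons_uniq inE negb_or => /andP[/andP[ij _] U] /andP[j0 p].
rewrite /= IH // /tau /isV /isrdd /islda !exprD.
have jk : j != head 0%N w.
  case: w U {IH p} => [|k w]; first by rewrite -lt0n.
  by rewrite cons_uniq inE negb_or => /andP[/andP[]].
case: (ltngtP i j) ij => // _ _; case: (ltngtP j (head 0%N w)) jk => // _ _ /=;
  rewrite ?expr1 ?expr0; ring.
Qed.

Definition stat x y z a b w : R :=
  wt x y z 0 w * a ^+ (lr_max 0 w).-1 * b ^+ (rl_max w).-1.

Definition Pw n x y z a b : R := \sum_(s : 'S_n.+1) stat x y z a b (word s).

(** There is one peak more than valleys, so [u1] and [u2] have equal exponents. *)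
Lemma PnE n (u1 u2 u3 u4 a b : R) :
  Pn n u1 u2 u3 u4 a b = Pw n (u1 * u2) u3 u4 a b.
Proof.
apply: eq_bigr => s _.
rewrite LRmaxE RLmaxE WstE VstE rddE ldaE /stat wtE ?word_uniq ?word_gt0 //.
have -> : count3 isW 0 (word s) = (count3 isV 0 (word s)).+1.
  case: (word s) (size_word s) (word_uniq s) (word_gt0 s) => [//|c w] _ U p.
  by rewrite -(count3_WV U p) ltn0 addn0.
by rewrite exprMn.
Qed.

Lemma lr_max_gt0 w : w != [::] -> all (ltn 0) w -> (0 < lr_max 0 w)%N.
Proof. by case: w => [//|c w] _ /= /andP[->]. Qed.

Lemma rl_max_gt0 w : w != [::] -> (0 < rl_max w)%N.
Proof.
elim: w => [//|c [//|d w] IH] _.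
exact: leq_trans (IH isT) (leq_addl _ _).
Qed.

Lemma lr_max_map_shift m w : lr_max (shift m) (map shift w) = lr_max m w.
Proof.
elim: w m => [//|c w IH] m /=; rewrite ltn_shift; congr (_ + _)%N.
by rewrite -IH; congr lr_max; rewrite /shift; lia.
Qed.

Lemma rl_max_map_shift w : rl_max (map shift w) = rl_max w.
Proof.
elim: w => [//|c w IH] /=; rewrite IH all_map; congr (_ + _)%N.
by congr nat_of_bool; apply: eq_all => d /=; rewrite ltn_shift.
Qed.

Lemma wt_map_shift x y z i w : wt x y z (shift i) (map shift w) = wt x y z i w.
Proof.
elim: w i => [//|c w IH] i /=; rewrite IH; congr (_ * _).
have -> : head 0%N (map shift w) = shift (head 0%N w) by case: w {IH}.
by rewrite /tau !ltn_shift.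
Qed.

(** Only comparisons among letters and with the boundary 0 matter, and [shift] preserves them. *)
Lemma stat_map_shift x y z a b w :
  stat x y z a b (map shift w) = stat x y z a b w.
Proof.
by rewrite /stat rl_max_map_shift (lr_max_map_shift 0) (wt_map_shift x y z 0).
Qed.

(** Each permutation of [n + 2] letters arises exactly once by inserting a smallest letter into one
    of [n + 1] letters. *)
Lemma Pw_recl n x y z a b : Pw n.+1 x y z a b =
  \sum_(s : 'S_n.+1) \sum_(k < n.+2)
     stat x y z a b (ins k (map shift (word s))).
Proof.
rewrite exchange_big pair_big /= /Pw.
rewrite (reindex (fun p : 'I_n.+2 * 'S_n.+1 => lift_perm p.1 ord0 p.2)) /=.
  by apply: eq_bigr => -[k s] _; rewrite word_lift_perm.
(* Injectivity suffices, as both sides have [(n + 2)!] elements; the position is recovered as the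
   preimage of 0. *)
apply: onW_bij; apply: inj_card_bij; last first.
  by rewrite card_prod !card_Sn card_ord factS.
move=> [i s] [j t] /= E.
have ti : lift_perm j ord0 t i = ord0 by rewrite -E lift_perm_id.
have {ti} ij : i = j.
  apply: (@perm_inj _ (lift_perm j ord0 t)).
  by rewrite ti lift_perm_id.
rewrite -ij in E *; congr (_, _); apply/permP => k.
have := congr1 (fun u : 'S_n.+2 => u (lift i k)) E.
by rewrite !lift_perm_lift => /lift_inj.
Qed.

(** * Insertion into the gaps as a derivation *)

Section Gaps.
Variables (x y z a b : R) (D : R -> R).
Hypothesis D1 : D 1 = 0.
Hypothesis DM : forall f g, D (f * g) = D f * g + f * D g.
Hypotheses (Dx : D x = x * (y + z)) (Dy : D y = x) (Dz : D z = x).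

(* The last summand is the part of the derivative of the first letter that
   comes from the descent in front of it. *)
Lemma wt_deriv i j w : all (ltn 1) (j :: w) ->
  D (wt x y z i (j :: w)) =
  \sum_(k < size w) wt x y z i (ins k.+1 (j :: w)) +
  (if (i < j)%N then 0 else x * tau x y z 1 j (head 0%N w) * wt x y z j w).
Proof.
elim: w i j => [|k w IH] i j.
  rewrite big_ord0 add0r /= DM D1 mulr0 addr0 !mulr1 andbT => j1.
  by rewrite /tau ltn0 j1; case: ltnP => _; rewrite ?Dy ?mulr1.
move=> /andP[j1 /[dup] p /andP[k1 _]].
rewrite -[wt _ _ _ i _]/(tau x y z i j k * wt x y z j (k :: w)) DM IH //.
rewrite -[size (k :: w)]/(size w).+1 big_ord_recl.
set S := \sum_(l < size w) wt x y z j _.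
(* Insertions behind [k] keep the factor of [j]. The gap between [j] and [k] remains, settled by
   comparing neighbouring letters. *)
rewrite (_ : \sum_(l < size w) _ = tau x y z i j k * S).
  have {}j1 : (1 < j)%N := j1; have {}k1 : (1 < k)%N := k1.
  rewrite /ins /= /tau j1 k1 (ltnNge j 1) (ltnW j1) /=.
  by case: (ltnP i j); case: (ltnP j k) => _ _; rewrite ?D1 ?Dx ?Dy ?Dz; case: ltnP => _; ring.
by rewrite mulr_sumr; apply: eq_bigr.
Qed.

Lemma lr_max_1_0 w : all (ltn 1) w -> lr_max 1 w = lr_max 0 w.
Proof.
case: w => [//|c w] /= /andP[c1 _]; rewrite c1 (ltnW c1) max0n.
by congr (_ + lr_max _ _)%N; lia.
Qed.

(** Behind a larger letter, the inserted 1 is no record and does not affect later ones. *)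
Lemma lr_max_ins m k w : (0 < k <= size w)%N -> all (ltn 1) w ->
  lr_max m (ins k w) = lr_max m w.
Proof.
elim: k m w => [//|[|k] IH] m [//|c w] km /= /andP[c1 p].
  rewrite /ins /= take0 drop0 /=; congr (_ + _)%N.
  rewrite (_ : (maxn m c < 1)%N = false) ?add0n; last lia.
  by congr lr_max; lia.
rewrite -[LHS]/((m < c) + lr_max (maxn m c) (ins k.+1 w))%N.
by rewrite IH.
Qed.

Lemma rl_max_ins k w : (k < size w)%N -> all (ltn 1) w ->
  rl_max (ins k w) = rl_max w.
Proof.
elim: k w => [|k IH] [//|c w] km /= /andP[c1 p].
  by rewrite /ins /= ltnNge (ltnW c1).
rewrite -[RHS]/(all (gtn c) w + rl_max w)%N -(IH w) //.
congr (_ + _)%N; rewrite /ins all_cat /= c1 /= -all_cat cat_take_drop //.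
Qed.

Lemma rl_max_ins_end w : all (ltn 1) w -> rl_max (ins (size w) w) = (rl_max w).+1.
Proof.
rewrite /ins take_size drop_size.
elim: w => [//|c w IH] /= /andP[c1 p].
by rewrite IH // all_cat /= c1 !andbT addnS.
Qed.

Lemma wt_ins_end i w : w != [::] -> all (ltn 1) w ->
   wt x y z i (ins (size w) w) = wt x y z i w * y.
Proof.
rewrite /ins take_size drop_size.
elim: w i => [//|c [|d w] IH] i _ /= /andP[c1 p].
  by rewrite /tau !ltn0 (ltnNge c 1) (ltnW c1) /= !mulr1.
have := IH c isT p; rewrite /= => ->; ring.
Qed.

(** A leading 1 is a new left-to-right maximum and a double ascent. The former first letter now
    follows 1 instead of 0 and keeps its type. *)
Lemma stat_ins_front w : w != [::] -> all (ltn 1) w ->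
  stat x y z a b (ins 0 w) = a * z * stat x y z a b w.
Proof.
move=> w0 p; have lr0 := lr_max_gt0 w0 (sub_all (fun d => @ltnW 1 d) p).
rewrite /stat /ins take0 drop0.
case: w w0 p lr0 => [//|c w] _ p lr0.
have {}c1 : (1 < c)%N by case/andP: p.
have lrE : lr_max 0 (1%N :: c :: w) = (lr_max 0 (c :: w)).+1.
  by rewrite -(lr_max_1_0 p).
have rlE : rl_max (1%N :: c :: w) = rl_max (c :: w).
  by rewrite [LHS]/= (ltnNge c 1) (ltnW c1).
have wE : wt x y z 0 (1%N :: c :: w) = z * wt x y z 0 (c :: w).
  by rewrite /= /tau c1 (ltnW c1).
by rewrite cat0s lrE rlE wE -{1}(prednK lr0) exprS; ring.
Qed.

(** A final 1 is a new right-to-left maximum and a double descent; the former last letter keeps its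
    type. *)
Lemma stat_ins_end w : w != [::] -> all (ltn 1) w ->
  stat x y z a b (ins (size w) w) = b * y * stat x y z a b w.
Proof.
move=> w0 p; have rl0 := rl_max_gt0 w0.
rewrite /stat lr_max_ins ?leqnn ?lt0n ?size_eq0 ?w0 // rl_max_ins_end //.
rewrite wt_ins_end // -{1}(prednK rl0) exprS; ring.
Qed.

(** The interior gaps leave both record counts fixed, so [wt_deriv] sums them; its extra term
    vanishes because the first letter exceeds 0. *)
Lemma sum_stat_ins w : w != [::] -> all (ltn 1) w ->
  \sum_(k < (size w).+1) stat x y z a b (ins k w) =
  (a * z + b * y) * stat x y z a b w +
  D (wt x y z 0 w) * a ^+ (lr_max 0 w).-1 * b ^+ (rl_max w).-1.
Proof.
move=> w0 p; case: w w0 p => [//|c w] w0 p.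
have c0 : (0 < c)%N by case/andP: p => /ltnW.
rewrite big_ord_recl big_ord_recr [LHS]/= stat_ins_front // (stat_ins_end w0 p).
rewrite (wt_deriv 0 p) c0 addr0 !mulr_suml.
rewrite [X in _ + (X + _)](eq_bigr (fun k : 'I_(size w) => wt x y z 0 (ins k.+1 (c :: w)) *
  a ^+ (lr_max 0 (c :: w)).-1 * b ^+ (rl_max (c :: w)).-1)); first by ring.
by move=> [k /= kw] _; rewrite /stat lr_max_ins ?rl_max_ins //= ?ltnS // ltnW.
Qed.

Hypotheses (DD : forall f g, D (f + g) = D f + D g) (Da : D a = 0) (Db : D b = 0).

Lemma D_const_exp c k : D c = 0 -> D (c ^+ k) = 0.
Proof.
by move=> Dc; elim: k => [//|k IH]; rewrite exprS DM Dc IH mul0r mulr0 addr0.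
Qed.

Lemma Pw_deriv n : D (Pw n x y z a b) + (a * z + b * y) * Pw n x y z a b =
  Pw n.+1 x y z a b.
Proof.
have D0 : D 0 = 0 by apply: (addrI (D 0)); rewrite -DD !addr0.
rewrite Pw_recl /Pw (big_morph D DD D0) mulr_sumr -big_split /=.
apply: eq_bigr => s _; have [w0 p] : word s != [::] /\ all (ltn 0) (word s).
  by rewrite -size_eq0 size_word word_gt0.
have := @sum_stat_ins (map shift (word s)); rewrite size_map size_word => ->.
- rewrite stat_map_shift (lr_max_map_shift 0) rl_max_map_shift.
  rewrite (wt_map_shift _ _ _ 0) addrC; congr (_ + _).
  by rewrite /stat !DM !D_const_exp // !mulr0 !addr0.
- by rewrite -size_eq0 size_map size_eq0.
by rewrite all_map; apply: sub_all p => c; rewrite /shift /=; lia.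
Qed.

(** Induction by the Leibniz rule and [Pw_deriv]; the base is the one-letter word, of weight 1. *)
Lemma Pw_iter_deriv E n : D E = (a * z + b * y) * E ->
  iter n D E = Pw n x y z a b * E.
Proof.
move=> DE; elim: n => [|n IH]; last by rewrite iterS IH DM DE -Pw_deriv; ring.
rewrite /Pw (big_pred1 1%g) => [|s]; last first.
  by apply/esym/eqP/permP => i; rewrite !ord1.
have -> : word (1%g : 'S_1) = [:: 1%N].
  by rewrite /word enum_ordSl enum_ord0 /= perm1.
by rewrite /stat /= /tau /= expr0 !mulr1 mul1r.
Qed.

End Gaps.
End Weights.

(** Serves to pass from [Pw] over power series to [Pw] at the constant terms. *)
Lemma Pw_rmorph (R S : comNzRingType) (f : {rmorphism R -> S}) n x y z a b :
  f (Pw n x y z a b) = Pw n (f x) (f y) (f z) (f a) (f b).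
Proof.
have wf i w : f (wt x y z i w) = wt (f x) (f y) (f z) i w.
  elim: w i => [|j w IH] i /=; first exact: rmorph1.
  by rewrite rmorphM IH /tau; do 2!case: ifP => _ //; rewrite rmorph1.
rewrite rmorph_sum; apply: eq_bigr => s _.
by rewrite /stat !rmorphM !rmorphXn wf.
Qed.

End Words.

(** * The ring of formal power series *)

Section Series.
Set Implicit Arguments. Unset Strict Implicit.
Variable K : fieldType.
Implicit Types (f g h : fps K) (p q : {poly K}) (n N : nat).

HB.instance Definition _ := gen_eqMixin (fps K).
HB.instance Definition _ := gen_choiceMixin (fps K).

Lemma fpsP f g : (forall n, f n = g n) -> f = g. Proof. exact: funext. Qed.

Definition fps_zero : fps K := fun=> 0.
Definition fps_opp f : fps K := fun n => - f n.
Definition fps_add f g : fps K := fun n => f n + g n.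

Lemma fps_addA : associative fps_add.
Proof. by move=> f g h; apply: fpsP => n; apply: addrA. Qed.
Lemma fps_addC : commutative fps_add.
Proof. by move=> f g; apply: fpsP => n; apply: addrC. Qed.
Lemma fps_add0 : left_id fps_zero fps_add.
Proof. by move=> f; apply: fpsP => n; apply: add0r. Qed.
Lemma fps_addN : left_inverse fps_zero fps_opp fps_add.
Proof. by move=> f; apply: fpsP => n; apply: addNr. Qed.

HB.instance Definition _ :=
  GRing.isZmodule.Build (fps K) fps_addA fps_addC fps_add0 fps_addN.

(** Commutativity, associativity and the Leibniz rule are inherited from polynomials, as coefficient
    [n] of a product involves only coefficients up to [n]. *)
Definition trunc N f : {poly K} := \poly_(i < N) f i.

Lemma coef_trunc N f i : (i < N)%N -> (trunc N f)`_i = f i.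
Proof. by move=> iN; rewrite coef_poly iN. Qed.

Lemma fps_mul_trunc N f g p q n : (n < N)%N ->
  (forall i, (i < N)%N -> p`_i = f i) -> (forall i, (i < N)%N -> q`_i = g i) ->
  fps_mul f g n = (p * q)`_n.
Proof.
move=> nN pf qg; rewrite coefM; apply: eq_bigr => -[i /= in_] _.
by rewrite pf ?qg //; apply: leq_ltn_trans nN; rewrite ?leq_subr.
Qed.

Lemma fps_mulC : commutative (@fps_mul K).
Proof.
move=> f g; apply: fpsP => n.
have T := @coef_trunc n.+1; rewrite !(fps_mul_trunc (ltnSn n) (T _) (T _)).
by rewrite mulrC.
Qed.

Lemma fps_mulA : associative (@fps_mul K).
Proof.
move=> f g h; apply: fpsP => n; have T := @coef_trunc n.+1.
rewrite (fps_mul_trunc (ltnSn n) (T f) (q := trunc n.+1 g * trunc n.+1 h)).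
  rewrite (fps_mul_trunc (ltnSn n) (p := trunc n.+1 f * trunc n.+1 g) _ (T h)).
    by rewrite mulrA.
  by move=> i iN; rewrite (fps_mul_trunc iN (T _) (T _)).
by move=> i iN; rewrite (fps_mul_trunc iN (T _) (T _)).
Qed.

Lemma fps_mul1 : left_id (fps_one K) (@fps_mul K).
Proof.
move=> f; apply: fpsP => n; rewrite /fps_mul big_ord_recl /= subn0 mul1r.
by rewrite big1 ?addr0 // => i _; rewrite /fps_one mul0r.
Qed.

Lemma fps_mulDl : left_distributive (@fps_mul K) fps_add.
Proof.
move=> f g h; apply: fpsP => n; rewrite /fps_add -big_split.
by apply: eq_bigr => i _; rewrite mulrDl.
Qed.

Lemma fps_one_neq0 : fps_one K != 0.
Proof.
apply/eqP => /(congr1 (fun f => f 0%N)) /eqP.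
by rewrite /fps_one oner_eq0.
Qed.

HB.instance Definition _ := GRing.Zmodule_isComNzRing.Build (fps K)
  fps_mulA fps_mulC fps_mul1 fps_mulDl fps_one_neq0.

Lemma fps_mulE f g n : (f * g) n = \sum_(i < n.+1) f i * g (n - i)%N.
Proof. by []. Qed.
Lemma fps_mul0E f g : (f * g) 0%N = f 0%N * g 0%N.
Proof. by rewrite fps_mulE big_ord1. Qed.
Lemma fps_addE f g n : (f + g) n = f n + g n. Proof. by []. Qed.
Lemma fps_oppE f n : (- f) n = - f n. Proof. by []. Qed.
Lemma fps_sumE I (r : seq I) (P : pred I) (F : I -> fps K) n :
  (\sum_(i <- r | P i) F i) n = \sum_(i <- r | P i) F i n.
Proof. exact: (big_morph (fun f => f n) (fun f g => fps_addE f g n)). Qed.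
Lemma fps_oneE n : (1 : fps K) n = (n == 0%N)%:R. Proof. by []. Qed.
Lemma fps_powE f k : fps_pown f k = f ^+ k.
Proof. by elim: k => [//|k IH]; rewrite exprS -IH. Qed.

Lemma fps_pow_small f k n : f 0%N = 0 -> (n < k)%N -> (f ^+ k) n = 0.
Proof.
move=> f0; elim: k n => [//|k IH] n nk; rewrite exprS fps_mulE big1 // => i _.
case: i => [[|i] /= lin]; first by rewrite f0 mul0r.
by rewrite IH ?mulr0 //; lia.
Qed.

(** * Constants and differentiation *)

Definition fconst (c : K) : fps K := fun n => if n == 0%N then c else 0.

Lemma fconst_mul c f n : (fconst c * f) n = c * f n.
Proof.
rewrite fps_mulE big_ord_recl /= subn0 big1 ?addr0 // => i _.
by rewrite /fconst mul0r.
Qed.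

Definition fderiv f : fps K := fun n => f n.+1 *+ n.+1.

Lemma fderivD f g : fderiv (f + g) = fderiv f + fderiv g.
Proof. by apply: fpsP => n; rewrite /fderiv !fps_addE mulrnDl. Qed.

Lemma fderivM f g : fderiv (f * g) = fderiv f * g + f * fderiv g.
Proof.
apply: fpsP => n; have T := @coef_trunc n.+2.
have E h i : (i < n.+1)%N -> ((trunc n.+2 h)^`())`_i = fderiv h i.
  by move=> iN; rewrite coef_deriv T.
rewrite fps_addE {1}/fderiv -[f * g]/(fps_mul f g) (fps_mul_trunc (ltnSn n.+1) (T _) (T _)).
rewrite -coef_deriv derivM coefD; congr (_ + _); symmetry.
  apply: (fps_mul_trunc (ltnSn n) (E _)) => i iN; apply: T; exact: ltnW.
apply: (fps_mul_trunc (ltnSn n) _ (E _)) => i iN; apply: T; exact: ltnW.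
Qed.

Lemma fderiv_const c : fderiv (fconst c) = 0.
Proof. by apply: fpsP => n; rewrite /fderiv mul0rn. Qed.

Lemma fderiv_iter f n : iter n fderiv f 0%N = f n * n`!%:R.
Proof.
(* The induction needs every coefficient [m], not only the constant one. *)
suff H m : iter n fderiv f m * m`!%:R = f (n + m)%N * (n + m)`!%:R.
  by have := H 0%N; rewrite addn0 mulr1.
elim: n m => [//|n IH] m /=; rewrite addSnnS -IH factS /fderiv.
by rewrite natrM mulrA (mulr_natr _ m.+1).
Qed.

Lemma fconst_mulE c f : (fun n => c * f n) = fconst c * f.
Proof. by apply: fpsP => n; rewrite fconst_mul. Qed.

Lemma fconstM c d : fconst (c * d) = fconst c * fconst d.
Proof. by apply: fpsP => n; rewrite fconst_mul /fconst; case: eqP; rewrite ?mulr0. Qed.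

Lemma fconstD c d : fconst (c + d) = fconst c + fconst d.
Proof. by apply: fpsP => n; rewrite fps_addE /fconst; case: eqP; rewrite ?addr0. Qed.

Lemma fconstN c : fconst (- c) = - fconst c.
Proof. by apply: fpsP => n; rewrite fps_oppE /fconst; case: eqP; rewrite ?oppr0. Qed.

Lemma fconst1 : fconst 1 = 1.
Proof. by apply: fpsP => n; rewrite fps_oneE /fconst; case: eqP. Qed.

Lemma fderiv1 : fderiv 1 = 0.
Proof. by rewrite -fconst1 fderiv_const. Qed.

Lemma fderivN f : fderiv (- f) = - fderiv f.
Proof. by apply: fpsP => n; rewrite /fderiv !fps_oppE mulNrn. Qed.

Lemma fderiv_cmul c f : fderiv (fconst c * f) = fconst c * fderiv f.
Proof. by rewrite fderivM fderiv_const mul0r add0r. Qed.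

Lemma fderiv_sum I (r : seq I) (P : pred I) (F : I -> fps K) :
  fderiv (\sum_(i <- r | P i) F i) = \sum_(i <- r | P i) fderiv (F i).
Proof.
by apply: (big_morph _ fderivD); apply: fpsP => n; rewrite /fderiv mul0rn.
Qed.

Lemma fderiv_exp f k : fderiv (f ^+ k.+1) = fconst k.+1%:R * (f ^+ k * fderiv f).
Proof.
elim: k => [|k IH]; first by rewrite expr1 expr0 fconst1 !mul1r.
rewrite exprS fderivM IH -(addn1 k.+1) natrD fconstD fconst1 exprS; ring.
Qed.

Lemma fps_mul_agree f f' g n : (forall i, (i <= n)%N -> f i = f' i) ->
  (f * g) n = (f' * g) n.
Proof.
by move=> E; rewrite !fps_mulE; apply: eq_bigr => -[i /= i_n] _; rewrite E.
Qed.

(** * Exponential, logarithm and powers in characteristic zero *)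

Hypothesis hK : [pchar K] =i pred0.

Lemma natrS_neq0 n : n.+1%:R != 0 :> K.
Proof. by rewrite ((pcharf0P K).1 hK). Qed.

Lemma fact_neq0 n : n`!%:R != 0 :> K.
Proof. by rewrite ((pcharf0P K).1 hK) -lt0n fact_gt0. Qed.

(** Used to prove identities of series: a zero derivative reduces them to constant terms. *)
Lemma fderiv_eq0 f : fderiv f = 0 -> f = fconst (f 0%N).
Proof.
move=> f'0; apply: fpsP => -[//|n]; apply/eqP.
have /eqP := congr1 (fun g : fps K => g n) f'0.
by rewrite /fderiv -mulr_natr mulf_eq0 (negPf (natrS_neq0 n)) orbF.
Qed.

(** Terms with [k > n] vanish at [n], so one bound [N] serves all these coefficients and the finite
    sum can be differentiated termwise. *)
Lemma fps_exp_trunc f N n : f 0%N = 0 -> (n < N)%N ->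
  fps_exp f n = (\sum_(k < N) fconst k`!%:R^-1 * f ^+ k) n.
Proof.
move=> f0 nN; rewrite fps_sumE /fps_exp (big_ord_widen N (fun k => fps_pown f k n / k`!%:R)) //.
rewrite big_mkcond; apply: eq_bigr => k _; rewrite fconst_mul fps_powE mulrC.
by case: ltnP => // nk; rewrite fps_pow_small ?mulr0.
Qed.

Lemma fps_exp0 f : fps_exp f 0%N = 1.
Proof. by rewrite /fps_exp big_ord1 /= fact0 divr1. Qed.

Lemma fderiv_fps_exp f : f 0%N = 0 -> fderiv (fps_exp f) = fderiv f * fps_exp f.
Proof.
move=> f0; apply: fpsP => n.
rewrite {1}/fderiv (fps_exp_trunc f0 (ltnSn n.+1)) -[LHS]/(fderiv _ n).
rewrite fderiv_sum big_ord_recl expr0 mulr1 fderiv_const add0r mulrC.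
(* Only coefficients up to [n] of the exponential enter, so a sum with one term fewer may replace
   it. *)
rewrite (fps_mul_agree (f' := \sum_(k < n.+1) fconst k`!%:R^-1 * f ^+ k)).
  rewrite mulr_suml; congr (_ n); apply: eq_bigr => k _.
  rewrite fderiv_cmul fderiv_exp !mulrA -fconstM; congr (fconst _ * _ * _).
  by rewrite factS natrM invfM mulrAC mulVf ?natrS_neq0 ?mul1r.
by move=> i i_n; apply: fps_exp_trunc.
Qed.

Lemma fps_log0 f : fps_log f 0%N = 0.
Proof. by rewrite /fps_log big_geq. Qed.

Lemma fps_log_trunc f N n : f 0%N = 1 -> (n <= N)%N ->
  fps_log f n =
  (\sum_(k < N) fconst ((-1) ^+ k / k.+1%:R) * (f - 1) ^+ k.+1) n.
Proof.
move=> f0 nN; rewrite /fps_log big_add1 /= big_mkord fps_sumE.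
rewrite (_ : (fun n0 : nat => _) = f - 1); last first.
  apply: fpsP => -[|m]; rewrite fps_addE fps_oppE fps_oneE //=.
  by rewrite subr0.
rewrite (big_ord_widen N (fun k => (-1) ^+ k.+2 / k.+1%:R * fps_pown (f - 1) k.+1 n)) //.
rewrite big_mkcond; apply: eq_bigr => k _; rewrite fconst_mul fps_powE.
case: ltnP => [_|nk]; first by rewrite 2!exprS !mulN1r opprK.
by rewrite fps_pow_small ?mulr0 // fps_addE fps_oppE fps_oneE f0 subrr.
Qed.

(** Termwise, the derivative of the logarithm is that of [f] times the geometric series in [1 - f],
    which inverts [f]. *)
Lemma fderiv_fps_log f : f 0%N = 1 -> f * fderiv (fps_log f) = fderiv f.
Proof.
move=> f0; apply: fpsP => n; pose H := f - 1.
have H0 : (- H) 0%N = 0.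
  by rewrite fps_oppE /H fps_addE fps_oppE fps_oneE f0 subrr oppr0.
rewrite mulrC.
rewrite (fps_mul_agree (f' := (\sum_(k < n.+1) (- H) ^+ k) * fderiv f)).
  (* By telescoping, [f] times the partial geometric sum is [1 - (- H) ^+ n.+1], whose correction
     starts beyond degree [n]. *)
  have fE : f = 1 - - H by rewrite opprK addrC subrK.
  rewrite mulrC mulrA {1}fE -opprB mulNr -subrX1 opprB mulrBl mul1r.
  rewrite fps_addE fps_oppE fps_mulE big1 ?subr0 // => -[i i_n] _.
  by rewrite fps_pow_small ?mul0r.
move=> i i_n; rewrite {1}/fderiv (@fps_log_trunc _ n.+1) // -[LHS]/(fderiv _ i).
rewrite fderiv_sum mulr_suml; congr (_ i); apply: eq_bigr => k _.
rewrite fderiv_cmul fderiv_exp mulrA -fconstM mulrVK ?unitfE ?natrS_neq0 //.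
rewrite fderivD fderivN fderiv1 subr0 mulrA (exprNn H).
suff -> : fconst ((-1) ^+ k) = (-1) ^+ k by [].
elim: {i_n i} (val k) => [|j IH]; first by rewrite fconst1.
by rewrite !exprS fconstM IH fconstN fconst1.
Qed.

Lemma fps_cpow0 f c : fps_cpow f c 0%N = 1.
Proof. exact: fps_exp0. Qed.

Lemma fderiv_fps_cpow f c : fderiv (fps_cpow f c) =
  fconst c * fderiv (fps_log f) * fps_cpow f c.
Proof.
rewrite /fps_cpow fconst_mulE fderiv_fps_exp ?fderiv_cmul //.
by rewrite fps_mul0E fps_log0 mulr0.
Qed.

(** The product has derivative 0 and constant term 1. *)
Lemma fps_cpowN1 f : f 0%N = 1 -> f * fps_cpow f (- 1) = 1.
Proof.
move=> f0; rewrite [LHS]fderiv_eq0.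
  by rewrite fps_mul0E f0 fps_cpow0 mulr1 fconst1.
rewrite fderivM fderiv_fps_cpow -(fderiv_fps_log f0) fconstN fconst1; ring.
Qed.

Definition cst_coef (f : fps K) : K := f 0%N.

Lemma cst_coef_zmod : zmod_morphism cst_coef. Proof. by []. Qed.
Lemma cst_coef_monoid : monoid_morphism cst_coef.
Proof. by split=> // f g; apply: fps_mul0E. Qed.

HB.instance Definition _ := GRing.isZmodMorphism.Build (fps K) K cst_coef cst_coef_zmod.
HB.instance Definition _ :=
  GRing.isMonoidMorphism.Build (fps K) K cst_coef cst_coef_monoid.

(** * The bracketed series and its differential system *)

Section Bracket.
Variables u1 u2 u3 u4 : K.
Let G := bracket u1 u2 u3 u4.
Let disc := (u3 + u4) ^+ 2 - 4%:R * u1 * u2.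

Lemma bracket0 : G 0%N = 1.
Proof. by rewrite /G /bracket /= expr0 fact0 expn0 muln1 divr1. Qed.

Lemma fderiv_bracket0 : fderiv G 0%N = - ((u3 + u4) / 2%:R).
Proof.
by rewrite /fderiv /G /bracket /= expr0 expn1 -[1`!]/1%N muln1 mulr1 mulNr.
Qed.

(** Both [cosh(st/2)] and [sinh(st/2)/s] solve [f'' = (s/2)^2 f], where [s^2 = disc]. *)
Lemma fderiv2_bracket : fderiv (fderiv G) = fconst (disc / 4%:R) * G.
Proof.
apply: fpsP => n; rewrite fconst_mul /fderiv /G /bracket /= negbK.
rewrite -/disc -(mulr_natr _ n.+1) -(mulr_natr _ n.+2) !factS !expnS !natrM exprS.
have e1 : 1 + n%:R != 0 :> K by rewrite nat1r natrS_neq0.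
have e2 : 2 + n%:R != 0 :> K by rewrite -natrD natrS_neq0.
have e3 : (2 ^ n)%:R != 0 :> K by rewrite natrX expf_neq0 ?natrS_neq0.
by case: odd => /=; field; rewrite e1 e2 e3 fact_neq0 (natrS_neq0 1) (natrS_neq0 3).
Qed.

(** This is the first integral of the equation [G'' = (disc/4) G], evaluated at [t = 0]. *)
Lemma bracket_invariant :
  fderiv G ^+ 2 - fconst (disc / 4%:R) * G ^+ 2 = fconst (u1 * u2).
Proof.
rewrite [LHS]fderiv_eq0; last first.
  rewrite fderivD fderivN fderiv_cmul !expr2 !fderivM fderiv2_bracket; ring.
have n2 := natrS_neq0 1; have n4 := natrS_neq0 3.
congr fconst.
rewrite -[LHS]/(cst_coef (fderiv G ^+ 2 - fconst (disc / 4%:R) * G ^+ 2)).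
rewrite rmorphB rmorphXn rmorphM rmorphXn /=.
rewrite /cst_coef bracket0 fderiv_bracket0 /fconst /disc /=; field.
by rewrite n2 n4.
Qed.

Lemma egf_coef a b n :
  Pw n (u1 * u2) u3 u4 a b / n`!%:R = rhs u1 u2 u3 u4 a b n.
Proof.
(* [W] is [1/G]; the shift by [h] gives [Y] and [Z] the constant terms [u3] and [u4]. *)
pose W := fps_cpow G (- 1); pose h := fconst ((u3 - u4) / 2%:R).
pose X := fconst (u1 * u2) * W ^+ 2.
pose Y := - (fderiv G * W) + h; pose Z := - (fderiv G * W) - h.
have GW : G * W = 1 by apply: fps_cpowN1; apply: bracket0.
have dlog : fderiv (fps_log G) = fderiv G * W.
  by rewrite -(fderiv_fps_log bracket0) mulrAC GW mul1r.
have dW : fderiv W = - (fderiv G * W ^+ 2).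
  rewrite /W fderiv_fps_cpow dlog fconstN fconst1 -/W; ring.
have dh : fderiv h = 0 := fderiv_const _.
have dX : fderiv X = X * (Y + Z).
  rewrite /X /Y /Z fderiv_cmul expr2 fderivM dW; ring.
have dGW : fderiv (- (fderiv G * W)) = X.
  rewrite fderivN fderivM dW fderiv2_bracket /X -bracket_invariant.
  (* Replacing the factor 1 by [G * W] makes the invariant times [W ^+ 2] appear. *)
  transitivity (fderiv G ^+ 2 * W ^+ 2 - fconst (disc / 4%:R) * G * W * 1); first by ring.
  by rewrite -[in LHS]GW; ring.
have dY : fderiv Y = X by rewrite /Y fderivD dGW dh addr0.
have dZ : fderiv Z = X by rewrite /Z fderivD dGW fderivN dh subr0.
(* The logarithmic derivative of the right-hand side is [(b - a) h - (a + b) G'/G]. *)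
have dE : fderiv (rhs u1 u2 u3 u4 a b) =
    (fconst a * Z + fconst b * Y) * rhs u1 u2 u3 u4 a b.
  rewrite -[rhs _ _ _ _ _ _]/(fps_exp _ * fps_cpow G _) fderivM fderiv_fps_exp //.
  rewrite fderiv_fps_cpow dlog.
  have -> : fderiv (fps_lin ((b - a) * (u3 - u4) / 2%:R)) = (fconst b - fconst a) * h.
    rewrite -fconstN -fconstD /h -fconstM mulrA.
    by apply: fpsP => -[|m]; rewrite /fderiv /fps_lin /fconst //= mul0rn.
  rewrite fconstN fconstD /Y /Z; ring.
have := Pw_iter_deriv fderiv1 fderivM dX dY dZ fderivD
  (fderiv_const a) (fderiv_const b) n dE.
(* At [t = 0] the [n]-th derivative is [n!] times coefficient [n], and the other side is [Pw] at the
   constant terms. *)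
move=> /(congr1 (fun f => cst_coef f)); rewrite rmorphM Pw_rmorph /= {1}/cst_coef fderiv_iter.
have -> : cst_coef (rhs u1 u2 u3 u4 a b) = 1.
  by rewrite /cst_coef -[LHS]/((fps_exp _ * fps_cpow G _) 0%N) fps_mul0E fps_exp0 fps_cpow0 mulr1.
have W0 : cst_coef W = 1 by apply: fps_cpow0.
have c0 c : cst_coef (fconst c) = c by [].
rewrite mulr1 !c0 /X /Y /Z !rmorphD !rmorphN !rmorphM /= !c0 W0.
rewrite -[cst_coef (fderiv G)]/(fderiv G 0%N).
have n2 := natrS_neq0 1.
rewrite fderiv_bracket0 !mulr1 opprK.
have -> : (u3 + u4) / 2%:R + (u3 - u4) / 2%:R = u3 by field.
have -> : (u3 + u4) / 2%:R - (u3 - u4) / 2%:R = u4 by field.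
by move=> <-; rewrite mulfK ?fact_neq0.
Qed.

End Bracket.

End Series.

Theorem theorem1p5 (K : fieldType) (hK : [pchar K] =i pred0)
    (u1 u2 u3 u4 a b : K) (n : nat) :
  Pn n u1 u2 u3 u4 a b / (n`!)%:R = rhs u1 u2 u3 u4 a b n.
Proof. by rewrite PnE egf_coef. Qed.
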